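(* For every graph $G$ with all connected components of even order we have that $\chi_{\mathsf{odd}}(G) \leq \mathsf{tw}(G)+1$, and this bound is tight.
   Context: All graphs are finite, simple and undirected. The order of a graph is its number of vertices. A graph is called odd if every vertex has odd degree. $\chi_{\mathsf{odd}}(G)$, the odd chromatic number of $G$, is the minimum number of odd induced subgraphs of $G$ whose vertex sets partition $V(G)$. (By a theorem of Scott, such a partition exists if and only if every connected component of $G$ has even order.) $\mathsf{tw}(G)$ denotes the tree-width of $G$. *)

(* Defs.v *)
(* Classical reasoning (boolp) serves only to take a minimum over all
   tree decompositions. *)
From HB Require Import structures.
From mathcomp Require Import all_boot all_order all_algebra.
From mathcomp Require Import boolp.

Set Implicit Arguments.
Unset Strict Implicit.
Unset Printing Implicit Defensive.

Import Order.TTheory GRing.Theory Num.Theory.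

Record sgraph := SGraph {
  vertex :> finType;
  adj : rel vertex;
  adj_sym : symmetric adj;
  adj_irr : irreflexive adj }.

Section Induced.
Variables (G : sgraph) (A : {set G}).

Definition induced_adj : rel {x : G | x \in A} :=
  fun x y => adj (val x) (val y).

Lemma induced_sym : symmetric induced_adj.
Proof. by move=> x y; exact: adj_sym. Qed.

Lemma induced_irr : irreflexive induced_adj.
Proof. by move=> x; exact: adj_irr. Qed.

Definition induced : sgraph := SGraph induced_sym induced_irr.
End Induced.

Definition degree (G : sgraph) (x : G) : nat := #|[set y | adj x y]|.

Definition odd_graph (G : sgraph) : bool := [forall x : G, odd (degree x)].

Definition component (G : sgraph) (x : G) : {set G} :=
  [set y | connect (@adj G) x y].

Definition even_components (G : sgraph) : Prop :=
  forall x : G, ~~ odd #|component x|.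

Definition odd_partition (G : sgraph) (P : {set {set G}}) : bool :=
  partition P [set: G] && [forall A in P, odd_graph (induced A)].

(* A partition of V(G) has at most #|G| blocks, so the default value #|G|.+1
   acts as +oo: it is attained exactly when G has no odd partition. *)
Definition chi_odd (G : sgraph) : nat :=
  \big[minn/#|G|.+1]_(P : {set {set G}} | odd_partition P) #|P|.

(* The empty graph counts as connected here. *)
Definition connected_graph (G : sgraph) : Prop :=
  forall x y : G, connect (@adj G) x y.

(* The bound 2 is needed because every edge xy gives a closed walk [:: x; y]
   in the sense of [cycle]. *)
Definition acyclic (G : sgraph) : Prop :=
  forall s : seq G, uniq s -> cycle (@adj G) s -> size s <= 2.

Definition is_tree (G : sgraph) : Prop :=
  [/\ 0 < #|G|, connected_graph G & acyclic G].

Definition tree_decomposition (G T : sgraph) (bag : T -> {set G}) : Prop :=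
  [/\ is_tree T,
      forall x : G, exists t : T, x \in bag t,
      forall x y : G, adj x y -> exists t : T, (x \in bag t) && (y \in bag t)
    & forall x : G, connected_graph (induced [set t : T | x \in bag t])].

Definition has_decomposition_of_bag_size (G : sgraph) (m : nat) : Prop :=
  exists (T : sgraph) (bag : T -> {set G}),
    tree_decomposition bag /\ \max_(t : T) #|bag t| = m.

Definition point_graph : sgraph :=
  @SGraph unit (fun _ _ => false) (fun _ _ => erefl) (fun _ => erefl).

Lemma ex_decomposition (G : sgraph) :
  exists m : nat, `[< has_decomposition_of_bag_size G m >].
Proof.
exists (\max_(t : point_graph) #|[set: G]|); apply/asboolP.
exists point_graph, (fun=> [set: G]); split=> //; split.
- split; first by rewrite card_unit.
  + by move=> [] []; exact: connect0.
  + by move=> s us _; apply: leq_trans (uniq_leq_size us (s2 := [:: tt]) _) _;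
      rewrite //; case=> _; rewrite inE.
- by move=> x; exists tt; rewrite inE.
- by move=> x y _; exists tt; rewrite !inE.
- move=> x [[] p] [[] q]; rewrite (bool_irrelevance p q); exact: connect0.
Qed.

(* Integer-valued, so that the empty graph has tree-width -1. *)
Definition treewidth (G : sgraph) : int :=
  ((ex_minn (ex_decomposition G))%:Z - 1)%R.

(* Main.v *)
(* Upper bound: among the partitions of V(G) into connected sets of even order,
   take one with the most parts. No part X splits further, and this forces every
   degree in G[X] to be odd: for v in X, each component of X - v has odd order
   and contains exactly one neighbour of v. The parts correspond to subtrees of
   the tree of a tree decomposition, at most tw(G) + 1 of them through any node,
   so they can be coloured with tw(G) + 1 colours with intersecting subtrees
   getting distinct colours. Distinct parts of the same colour are then
   non-adjacent, and the union of each colour class induces an odd subgraph.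

   Tightness: a vertex of degree two lies in the same block as exactly one of its
   two neighbours, so the neighbours lie in distinct blocks. Adding to K_{k+1} a
   common neighbour w_{ij} of i and j for every ordered pair (i, j), with w_{ii}
   a pendant vertex that makes the order (k+1)(k+2) even, separates all vertices
   of K_{k+1} without raising the tree-width when k >= 2. For k = 1 the path on
   four vertices is used instead. *)
Require Import Defs.
From HB Require Import structures.
From mathcomp Require Import all_boot all_order all_algebra.
From mathcomp Require Import boolp.
Import Order.TTheory GRing.Theory Num.Theory.

Set Implicit Arguments.
Unset Strict Implicit.
Unset Printing Implicit Defensive.

(** * Connected vertex sets and their components *)

Lemma connect_ind (T : finType) (e : rel T) (P : T -> Prop) x :
  P x -> (forall y z, connect e x y -> e y z -> P y -> P z) ->
  forall y, connect e x y -> P y.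
Proof.
move=> Px IP y /connectP[p]; elim/last_ind: p y => [|p z IHp] y /=.
  by move=> _ ->.
rewrite rcons_path last_rcons => /andP[pth ez] ->.
by apply: IP ez (IHp _ pth erefl); apply/connectP; exists p.
Qed.

Section Connectivity.
Variable G : sgraph.
Implicit Types (S X D : {set G}) (x y z v : G).

(** Restricting the relation on [G], instead of passing to [induced S], keeps all vertex sets in one
    type. *)
Definition adj_in S : rel G := [rel x y | [&& x \in S, y \in S & adj x y]].

Definition connected_set S :=
  [forall x in S, forall y in S, connect (adj_in S) x y].

Definition component_in S x : {set G} := [set y | connect (adj_in S) x y].

Definition inner_degree S x := #|[set y in S | adj x y]|.

Lemma connected_setP S :
  reflect {in S &, forall x y, connect (adj_in S) x y} (connected_set S).
Proof.
apply: (iffP 'forall_in_forall_inP) => H x y; first by move=> Sx; apply: H.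
by move=> Sx; apply: H.
Qed.

Lemma adj_in_connect_sym S : connect_sym (adj_in S).
Proof.
apply: sym_connect_sym => x y; rewrite /adj_in /= adj_sym.
by case: (x \in S); case: (y \in S).
Qed.

Lemma adj_in_sub S D : S \subset D -> subrel (adj_in S) (adj_in D).
Proof.
by move=> /subsetP sSD x y /and3P[Sx Sy xy]; apply/and3P; split; auto.
Qed.

Lemma connect_adj_in_sub S D :
  S \subset D -> subrel (connect (adj_in S)) (connect (adj_in D)).
Proof.
by move=> sSD; apply: connect_sub => x y /(adj_in_sub sSD)/connect1.
Qed.

Lemma connected_set_hub S v :
  {in S, forall x, connect (adj_in S) x v} -> connected_set S.
Proof.
move=> H; apply/connected_setP => x y Sx Sy.
by apply: connect_trans (H x Sx) _; rewrite adj_in_connect_sym H.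
Qed.

Lemma induced_connected_set S :
  connected_graph (induced S) -> connected_set S.
Proof.
move=> conS; apply/connected_setP => x y Sx Sy.
pose x' : induced S := Sub x Sx; pose y' : induced S := Sub y Sy.
have: forall b, connect (@adj (induced S)) x' b ->
  connect (adj_in S) x (val b).
  apply: connect_ind => [|a b _ ab IH]; first exact: connect0.
  apply: connect_trans IH (connect1 _).
  by rewrite /adj_in /= (valP a) (valP b).
by move/(_ y' (conS x' y')).
Qed.

Lemma component_in_sub S x : x \in S -> component_in S x \subset S.
Proof.
move=> Sx; apply/subsetP => y; rewrite inE.
by apply: (connect_ind (P := fun z => z \in S)) => // a b _ /and3P[].
Qed.

Lemma connected_component_in S x : connected_set (component_in S x).
Proof.
apply: (@connected_set_hub _ x) => y; rewrite inE => xy.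
rewrite adj_in_connect_sym; move: y xy; apply: connect_ind => // y z xy yz.
move/connect_trans; apply; apply: connect1; rewrite /adj_in /= !inE xy.
by rewrite (connect_trans xy (connect1 yz)); case/and3P: yz.
Qed.

Lemma component_in_eq S x y :
  y \in component_in S x -> component_in S y = component_in S x.
Proof.
rewrite inE => xy; apply/setP => z; rewrite !inE.
by rewrite (same_connect (@adj_in_connect_sym S) xy).
Qed.

(** A walk in [X] from [x] to [v] stays in the component until the step that first enters [v]. *)
Lemma component_in_nbr X v x : connected_set X -> v \in X -> x \in X :\ v ->
  exists2 a, a \in component_in (X :\ v) x & adj v a.
Proof.
move=> /connected_setP conX Xv XDx; have [xDv Xx] := setD1P XDx.
have : forall w, connect (adj_in X) x w ->
    w \in component_in (X :\ v) x \/
    exists2 a, a \in component_in (X :\ v) x & adj v a.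
  apply: connect_ind; first by left; rewrite inE.
  move=> y z _ /and3P[Xy Xz yz] [xy|]; last by right.
  have [zv|zDv] := eqVneq z v; first by right; exists y; rewrite // -zv adj_sym.
  left; move: (xy); rewrite !inE => /connect_trans; apply; apply: connect1.
  apply/and3P; split=> //; first exact: (subsetP (component_in_sub XDx)).
  by rewrite !inE zDv.
case/(_ v (conX x v Xx Xv)) => // /(subsetP (component_in_sub XDx)).
by rewrite !inE eqxx.
Qed.

(** Any remaining vertex reaches [v] through its own component of [X :\ v], which is disjoint from
    the removed one. *)
Lemma connected_setD_component X v x :
  connected_set X -> v \in X -> x \in X :\ v ->
  connected_set (X :\: component_in (X :\ v) x).
Proof.
move=> conX Xv XDx; set D := component_in _ x.
have vND : v \notin D.
  by apply/negP => /(subsetP (component_in_sub XDx)); rewrite !inE eqxx.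
apply: (@connected_set_hub _ v) => y /setDP[Xy yND].
have [->//|yDv] := eqVneq y v.
have XDy : y \in X :\ v by rewrite !inE yDv.
have [a ya va] := component_in_nbr conX Xv XDy.
have sE : component_in (X :\ v) y \subset X :\: D.
  apply/subsetP => z yz; rewrite inE.
  have := subsetP (component_in_sub XDy) z yz; rewrite inE => /andP[_ ->].
  rewrite andbT; apply: contra yND => Dz.
  rewrite /D -(component_in_eq Dz) (component_in_eq yz) inE; exact: connect0.
apply: connect_trans (connect_adj_in_sub sE _) (connect1 (y := v) (x := a) _).
  by have /connected_setP := @connected_component_in (X :\ v) y; apply;
    rewrite // inE.
by rewrite /adj_in /= (subsetP sE) // inE vND Xv adj_sym.
Qed.

(** * Partition into connected sets with odd inner degrees *)

Lemma odd_sum_odd (I : finType) (A : {set I}) (F : I -> nat) :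
  {in A, forall i, odd (F i)} -> odd (\sum_(i in A) F i) = odd #|A|.
Proof.
move=> oddF; rewrite -sum1_card !(big_morph odd oddD (erefl _ : odd 0 = false)).
exact: eq_bigr.
Qed.

(* The neighbours of [v] lie in distinct components of [X :\ v], and all of
   these components have odd order: otherwise an even set could be split off. *)
Lemma odd_inner_degree_unsplittable X : connected_set X -> ~~ odd #|X| ->
  (forall D, D \subset X -> D != set0 -> D != X ->
     connected_set D -> connected_set (X :\: D) -> odd #|D|) ->
  {in X, forall v, odd (inner_degree X v)}.
Proof.
move=> conX evX unsplit v Xv; set C := component_in (X :\ v).
set N := [set y in X | adj v y].
have XDN a : a \in N -> a \in X :\ v.
  rewrite !inE => /andP[-> va]; rewrite andbT.
  by apply: contraTneq va => ->; rewrite adj_irr.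
have Cx a : a \in C a by rewrite inE connect0.
have CsubX a : a \in N -> C a \subset X.
  by move=> Na; apply: subset_trans (component_in_sub (XDN _ Na)) (subD1set _ _).
have oddC a : a \in N -> odd #|C a|.
  move=> Na; apply: unsplit; rewrite ?CsubX ?connected_component_in //.
  - by apply/set0Pn; exists a.
  - apply: contraTneq Xv => <-; apply/negP.
    by move/(subsetP (component_in_sub (XDN _ Na))); rewrite !inE eqxx.
  - exact/connected_setD_component/XDN.
have injC : {in N &, injective C}.
  move=> a b Na Nb eqC; apply/eqP/negPn/negP => aDb.
  have Cb : b \in C a by rewrite eqC.
  (* [E] and [C a :\: E] contain [a] and [b] respectively, are connected, and can each be split off
     from [X]; so both are odd, against [oddC a]. *)
  set E := component_in (C a :\ b) a.
  have CDa : a \in C a :\ b by rewrite !inE aDb connect0.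
  have sEC : E \subset C a.
    exact: subset_trans (component_in_sub CDa) (subD1set _ _).
  have conE : connected_set E by apply: connected_component_in.
  have conCE : connected_set (C a :\: E).
    exact: connected_setD_component (connected_component_in _ _) Cb CDa.
  have bNE : b \notin E.
    by apply/negP => /(subsetP (component_in_sub CDa)); rewrite !inE eqxx.
  have Ea : a \in E by rewrite inE connect0.
  have vNC c : c \in N -> v \notin C c.
    move=> Nc; apply/negP => /(subsetP (component_in_sub (XDN _ Nc))).
    by rewrite !inE eqxx.
  (* [X :\: F] is connected as long as it keeps a neighbour of [v] in the
     remaining part of the component. *)
  have glue (F : {set G}) d : F \subset C a -> connected_set (C a :\: F) ->
      d \in C a :\: F -> d \in N -> connected_set (X :\: F).
    move=> sFC conCF CFd Nd; apply: (@connected_set_hub _ v) => y /setDP[Xy yNF].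
    have vXF : v \in X :\: F.
      by rewrite inE Xv andbT; apply: contra (vNC a Na); apply: subsetP.
    have [Cy|CNy] := boolP (y \in C a).
      apply: (@connect_trans _ _ d).
        apply: (@connect_adj_in_sub (C a :\: F)); first by rewrite setSD ?CsubX.
        by move/connected_setP: conCF; apply; rewrite // inE yNF.
      apply: connect1; rewrite /adj_in /= vXF; move: Nd; rewrite !inE adj_sym.
      by move=> /andP[-> ->]; case/setDP: CFd => _ ->.
    have /connected_setP : connected_set (X :\: C a).
      exact/connected_setD_component/XDN.
    move/(_ y v); rewrite !in_setD CNy Xy Xv vNC // => /(_ isT isT).
    by apply: connect_adj_in_sub; rewrite setDS.
  have CEK : C a :\: (C a :\: E) = E by rewrite setDDr setDv set0U (setIidPr sEC).
  have Xne D : v \notin D -> D != X by apply: contraNneq => ->.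
  have oE : odd #|E|.
    apply: unsplit => //; first exact: subset_trans sEC (CsubX a Na).
    - by apply/set0Pn; exists a.
    - by apply: Xne; apply: contra (vNC a Na); apply: subsetP.
    - by apply: (@glue E b) => //; rewrite inE bNE.
  have oCE : odd #|C a :\: E|.
    apply: unsplit => //.
    - exact: subset_trans (subsetDl _ _) (CsubX a Na).
    - by apply/set0Pn; exists b; rewrite inE bNE.
    - by apply: Xne; rewrite inE negb_and vNC ?orbT.
    - by apply: (@glue _ a); rewrite ?CEK ?subsetDl.
  have := oddC a Na.
  by rewrite -(cardsID E (C a)) (setIidPr sEC) oddD oE oCE.
(* [X :\ v] has odd order and splits into [#|N|] sets of odd order, so [#|N|] is odd. *)
have partC : partition (C @: N) (X :\ v).
  apply/and3P; split.
  - apply/eqP/setP => y; apply/bigcupP/idP.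
      case=> _ /imsetP[a Na ->]; apply/subsetP/component_in_sub/XDN => //.
    move=> XDy; have [a ya va] := component_in_nbr conX Xv XDy.
    have Na : a \in N.
      rewrite inE va andbT; have := subsetP (component_in_sub XDy) a ya.
      by case/setD1P.
    exists (C a); first exact: imset_f.
    by rewrite /C (component_in_eq ya) inE connect0.
  - apply/trivIsetP => _ _ /imsetP[a Na ->] /imsetP[b Nb ->] CD.
    rewrite -setI_eq0; apply: contraNT CD => /set0Pn[z /setIP[az bz]].
    by rewrite /C -(component_in_eq az) (component_in_eq bz).
  - by apply/imsetP => -[a _ /setP/(_ a)]; rewrite Cx inE.
have := card_partition partC; rewrite big_imset //= => cardX.
move: evX; rewrite (cardsD1 v) Xv oddD cardX odd_sum_odd //.
by rewrite /inner_degree -/N; case: (odd #|N|).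
Qed.

(** Provides the larger partition that contradicts maximality. *)
Lemma partition_split (P : {set {set G}}) X D :
  partition P [set: G] -> X \in P -> D \subset X -> D != set0 -> D != X ->
  partition (D |: (X :\: D |: P :\ X)) [set: G]
  /\ #|D |: (X :\: D |: P :\ X)| = #|P|.+1.
Proof.
move=> partP PX sDX D0 DX.
have partPX := partitionD1 partP PX.
have XD0 : X :\: D != set0.
  rewrite setD_eq0; apply: contra DX => sXD.
  by rewrite eqEsubset sDX.
have dis1 : [disjoint X :\: D & [set: G] :\: X].
  rewrite -setI_eq0; apply/eqP/setP => z; rewrite !inE andbT.
  by case: (z \in X); rewrite ?andbF.
have part1 := partitionU1 partPX XD0 dis1.
have dis2 : [disjoint D & (X :\: D) :|: ([set: G] :\: X)].
  rewrite -setI_eq0; apply/eqP/setP => z; rewrite !inE andbT.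
  case Dz: (z \in D) => //=; by rewrite (subsetP sDX).
have part2 := partitionU1 part1 D0 dis2.
have -> : [set: G] = D :|: ((X :\: D) :|: ([set: G] :\: X)).
  apply/setP => z; rewrite !inE andbT.
  by case: (z \in D); case: (z \in X).
split=> //.
have ninP (E : {set G}) (Q : {set {set G}}) B :
    partition Q B -> E != set0 -> [disjoint E & B] -> E \notin Q.
  move=> partQ E0; apply: contraL => QE; apply/negP => /disjoint_setI0.
  by move/setIidPl: (partitionS partQ QE) => ->; apply/eqP.
rewrite !cardsU1 (ninP _ _ _ part1) // (ninP _ _ _ partPX) //.
by rewrite (cardsD1 X P) PX.
Qed.

Lemma odd_connected_partition : even_components G ->
  exists P : {set {set G}}, [/\ partition P [set: G],
    {in P, forall X, connected_set X} &
    {in P, forall X, {in X, forall v, odd (inner_degree X v)}}].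
Proof.
move=> evG.
pose good (P : {set {set G}}) := partition P [set: G] &&
  [forall X in P, connected_set X && ~~ odd #|X|].
have compE x : component x = component_in [set: G] x.
  by apply/setP => y; rewrite !inE; apply: eq_connect => a b; rewrite /adj_in /= !inE.
(* The components of [G] form a good partition, so one with the most blocks exists. *)
have good0 : good [set component x | x : G].
  apply/andP; split; last first.
    apply/forall_inP => _ /imsetP[x _ ->].
    by rewrite evG compE connected_component_in.
  apply/and3P; split.
  - apply/eqP/setP => x; rewrite [RHS]inE; apply/bigcupP.
    by exists (component x); rewrite ?imset_f // inE connect0.
  - apply/trivIsetP => _ _ /imsetP[a Na ->] /imsetP[b Nb ->]; rewrite !compE.
    rewrite -setI_eq0; apply: contraNT => /set0Pn[z /setIP[az bz]].
    by rewrite -(component_in_eq az) (component_in_eq bz).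
  - by apply/imsetP => -[a _ /setP/(_ a)]; rewrite !inE connect0.
case: (arg_maxnP (fun P : {set {set G}} => #|P|) good0) => P.
case/andP=> partP /forall_inP goodP maxP.
exists P; split=> // X PX; case/andP: (goodP X PX) => // conX evX.
apply: odd_inner_degree_unsplittable => // D sDX D0 DX conD conXD.
(* An even [D] leaves [X :\: D] even, so splitting [X] would give a good partition with one more
   block. *)
apply/negPn/negP => evD.
have [partP' cardP'] := partition_split partP PX sDX D0 DX.
suff /maxP : good (D |: (X :\: D |: P :\ X)) by rewrite cardP' /= ltnn.
rewrite /good partP'; apply/forall_inP => E; rewrite !inE.
case/or3P => [/eqP->|/eqP->|/andP[_ /goodP]//]; first by rewrite conD.
rewrite conXD; move: evX; rewrite -(cardsID D X) (setIidPr sDX) oddD.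
by rewrite (negPf evD).
Qed.

End Connectivity.

(** * Leaves in acyclic graphs *)

Section AcyclicLeaf.
Variable T : sgraph.
Hypothesis acyT : acyclic T.
Implicit Types (S U : {set T}) (x y : T).

(* Otherwise every path inside [U] could be prolonged forever: a second
   neighbour lying on the path would close a cycle. *)
Lemma acyclic_leaf U : U != set0 ->
  exists2 x, x \in U & {in U &, forall y z, adj x y -> adj x z -> y = z}.
Proof.
move=> /set0Pn[x0 Ux0]; apply: contrapT => noleaf.
have branch x w : x \in U -> exists2 y, y \in U & adj x y && (y != w).
  move=> Ux; apply: contrapT => no; apply: noleaf; exists x => // y z Uy Uz xy xz.
  have eqw a : a \in U -> adj x a -> a = w.
    move=> Ua xa; apply/eqP/negPn/negP => aw.
    by apply: no; exists a; rewrite // xa.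
  exact: etrans (eqw y Uy xy) (esym (eqw z Uz xz)).
have long n : exists x p, [/\ path (@adj T) x p, uniq (x :: p),
    {subset x :: p <= U} & size p = n].
  elim: n => [|n [x [p [pth up pU sp]]]].
    by exists x0, [::]; split=> // z; rewrite inE => /eqP ->.
  have Ux : x \in U by apply: pU; rewrite mem_head.
  (* The new vertex must not step back along the path; for empty [p] the default [x] excludes
     nothing, as [adj] is irreflexive. *)
  have [y Uy /andP[xy ynp]] := branch x (head x p) Ux.
  have yx : y != x by apply: contraTneq xy => ->; rewrite adj_irr.
  exists y, (x :: p); split=> /=; rewrite ?sp //.
  - by rewrite adj_sym xy.
  - rewrite -/(uniq (x :: p)) up andbT inE negb_or yx /=.
    apply/negP => yp; case/splitPr: p / yp pth up pU sp ynp => p1 p2.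
    rewrite -cat_rcons cat_path -cat_cons cat_uniq.
    move=> /andP[pth _] /andP[up _] _ _ ynp.
    (* The closed walk has at most two vertices, so [p1] is empty and [y] is the head of [p], which
       was excluded. *)
    have := acyT up; rewrite /= rcons_path pth last_rcons adj_sym xy.
    move/(_ isT); rewrite size_rcons; case: p1 ynp {pth up} => //=.
    by rewrite eqxx.
  - by move=> z; rewrite inE => /orP[/eqP->//|]; apply: pU.
have [x [p [_ up _ sp]]] := long #|T|.
have := max_card (mem (x :: p)); rewrite (card_uniqP up) /= sp.
by rewrite ltnn.
Qed.

(** A path enters and leaves [x] through the same neighbour, so the detour can be cut out. *)
Lemma connected_set_leaf S x : connected_set S ->
  {in S &, forall y z, adj x y -> adj x z -> y = z} -> connected_set (S :\ x).
Proof.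
move=> /connected_setP conS leaf; apply/connected_setP => a b Sxa Sxb.
have [ax Sa] := setD1P Sxa; have [bx Sb] := setD1P Sxb.
(* At [x] itself the invariant speaks of the neighbours of [x] instead, since [x] is missing from
   [S :\ x]. *)
pose P z := if z == x then forall y, y \in S -> adj x y ->
  connect (adj_in (S :\ x)) a y else connect (adj_in (S :\ x)) a z.
suff: P b by rewrite /P (negPf bx).
move: b {Sxb bx Sb} (conS a b Sa Sb); apply: connect_ind.
  by rewrite /P (negPf ax) connect0.
move=> y z _ /and3P[Sy Sz yz]; rewrite /P.
have [eqyx|yx] := eqVneq y x.
  rewrite eqyx in yz; have [zx|zx] := eqVneq z x; last by apply.
  by rewrite zx adj_irr in yz.
move=> ay; have [eqzx|zx] := eqVneq z x.
  move=> w Sw xw; rewrite eqzx adj_sym in yz.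
  by rewrite (leaf w y).
apply: connect_trans ay (connect1 _).
by apply/and3P; split; rewrite // !inE ?zx ?yx.
Qed.

Lemma connected_set_nbr S x : connected_set S -> x \in S -> S != [set x] ->
  exists2 y, y \in S & adj x y.
Proof.
move=> conS Sx Sn1.
have [y Sxy] : exists y, y \in S :\ x.
  apply/set0Pn; apply: contra Sn1; rewrite setD_eq0 => sSx.
  by rewrite eqEsubset sSx sub1set.
have [a ya xa] := component_in_nbr conS Sx Sxy.
by exists a => //; have /setD1P[] := subsetP (component_in_sub Sxy) a ya.
Qed.

End AcyclicLeaf.

(** * Colouring of intersecting subtrees *)

Lemma extend_inj_coloring (I : finType) m (A Q : {set I}) (c : I -> 'I_m) :
  A \subset Q -> #|Q| <= m -> {in A &, injective c} ->
  exists2 c' : I -> 'I_m, {in Q &, injective c'} &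
    forall i, i \notin Q :\: A -> c' i = c i.
Proof.
move=> sAQ leQm injc; set B := Q :\: A; set F := ~: (c @: A).
have leBF : #|B| <= #|F|.
  rewrite [#|F|]cardsCs setCK card_ord card_in_imset // cardsD (setIidPr sAQ).
  exact: leq_sub2r.
pose c' i := if i \in B then nth (c i) (enum F) (index i (enum B)) else c i.
have c'F i : i \in B -> c' i \in F.
  move=> Bi; rewrite /c' Bi -mem_enum mem_nth // -cardE.
  by apply: leq_trans leBF; rewrite cardE index_mem mem_enum.
have c'A i : i \in Q -> i \notin B -> c' i \in c @: A.
  move=> Qi Bi; rewrite /c' (negPf Bi) imset_f //.
  by move: Bi; rewrite inE Qi andbT negbK.
exists c' => [i j Qi Qj|i Bi]; last by rewrite /c' (negPf Bi).
have [Bi|Bi] := boolP (i \in B); have [Bj|Bj] := boolP (j \in B).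
- rewrite /c' Bi Bj.
  have ltF k : k \in B -> index k (enum B) < size (enum F).
    by move=> Bk; rewrite -cardE (leq_trans _ leBF) // cardE index_mem mem_enum.
  rewrite (set_nth_default (c i) (c j)) ?ltF // => /eqP.
  rewrite nth_uniq ?enum_uniq ?ltF // => /eqP eqij.
  by rewrite -(nth_index i (s := enum B) (x := i)) ?mem_enum // eqij
    nth_index ?mem_enum.
- by move=> eqc; have := c'F i Bi; rewrite eqc inE c'A.
- by move=> eqc; have := c'F j Bj; rewrite -eqc inE c'A.
- rewrite /c' (negPf Bi) (negPf Bj); apply: injc.
    by move: Bi; rewrite inE Qi andbT negbK.
  by move: Bj; rewrite inE Qj andbT negbK.
Qed.

(* Induction on the host tree, removing a leaf [x]: only the subtrees reduced
   to [x] have to be recoloured, and they meet nothing outside [x]. *)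
Lemma subtree_coloring (T : sgraph) (I : finType) m (S : I -> {set T}) :
  acyclic T -> (forall i, connected_set (S i)) ->
  (forall t, #|[set i | t \in S i]| <= m.+1) ->
  exists c : I -> 'I_m.+1,
    forall i j, i != j -> ~~ [disjoint S i & S j] -> c i != c j.
Proof.
move=> acyT.
suff H n (U : {set T}) : #|U| = n -> forall S : I -> {set T},
    (forall i, S i \subset U) ->
    (forall i, connected_set (S i)) ->
    (forall t, #|[set i | t \in S i]| <= m.+1) ->
  exists c : I -> 'I_m.+1,
    forall i j, i != j -> ~~ [disjoint S i & S j] -> c i != c j.
  by apply: (H _ [set: T] erefl) => i; apply: subsetT.
elim: n U => [|n IHn] U cardU {}S SU conS loadS.
  exists (fun=> ord0) => i j _; rewrite -setI_eq0.
  have /eqP := SU i; move/eqP: cardU; rewrite cards_eq0 => /eqP ->.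
  by rewrite -/(_ \subset _) => /eqP; rewrite subset0 => /eqP ->; rewrite set0I eqxx.
have [x Ux leafx] : exists2 x, x \in U &
    {in U &, forall y z, adj x y -> adj x z -> y = z}.
  by apply: acyclic_leaf => //; rewrite -cards_eq0 cardU.
have [||i|t|c cP] := IHn (U :\ x) _ (fun i => S i :\ x).
- by move: cardU; rewrite (cardsD1 x) Ux => -[].
- by move=> i; apply: setSD.
- apply: connected_set_leaf => // y z Sy Sz.
  by apply: leafx; apply: (subsetP (SU i)).
- apply: leq_trans (loadS t); apply: subset_leq_card.
  by apply/subsetP => i; rewrite !inE => /andP[].
(* Subtrees in [Q] pass through [x]; those in [A] also contain the only neighbour of [x] in [U], so
   they still meet after the removal of [x]. *)
pose Q := [set i | x \in S i]; pose A := [set i in Q | S i != [set x]].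
have injc : {in A &, injective c}.
  move=> i j; rewrite !inE => /andP[Six Si1] /andP[Sjx Sj1] eqc.
  apply/eqP/idPn => ij.
  suff /(cP _ _ ij) : ~~ [disjoint S i :\ x & S j :\ x] by rewrite eqc eqxx.
  have [y Siy xy] := connected_set_nbr (conS i) Six Si1.
  have [z Sjz xz] := connected_set_nbr (conS j) Sjx Sj1.
  have eqyz : y = z.
    by apply: leafx xy xz; [apply: (subsetP (SU i)) | apply: (subsetP (SU j))].
  rewrite -setI_eq0; apply/set0Pn; exists y; rewrite !inE Siy eqyz Sjz -eqyz.
  by rewrite !andbT andbb; apply: contraTneq xy => ->; rewrite adj_irr.
have [||c' injc' c'E] := @extend_inj_coloring I m.+1 A Q c _ _ injc.
- by apply/subsetP => i; rewrite inE => /andP[].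
- exact: loadS.
exists c' => i j ij; rewrite -setI_eq0 => /set0Pn[t /setIP[Sit Sjt]].
have [eqtx|tx] := eqVneq t x.
  by apply: contra ij => /eqP/injc' -> //; rewrite inE -eqtx.
(* A subtree through some [t != x] is not [[set x]], so it keeps its colour. *)
have nB k : t \in S k -> k \notin Q :\: A.
  move=> Skt; rewrite !inE; case Skx: (x \in S k); rewrite ?andbF //= andbT negbK.
  by apply: contraTneq Skt => ->; rewrite inE.
rewrite !c'E ?nB //; apply: cP => //; rewrite -setI_eq0; apply/set0Pn.
by exists t; rewrite !inE tx Sit.
Qed.

(** * Upper bound from a tree decomposition *)

Section OddPartition.
Variable G : sgraph.

Lemma degree_induced (A : {set G}) (x : G) (Ax : x \in A) :
  @degree (induced A) (Sub x Ax) = inner_degree A x.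
Proof.
rewrite /degree /inner_degree -(card_imset _ val_inj); apply: eq_card => y.
rewrite inE; apply/imsetP/andP => [[z zP ->]|[Ay xy]].
  by move: zP; rewrite inE; split=> //; apply: valP.
by exists (Sub y Ay); rewrite // inE.
Qed.

Lemma odd_partitionP (P : {set {set G}}) :
  reflect (partition P [set: G] /\
           {in P, forall A : {set G}, {in A, forall x, odd (inner_degree A x)}})
          (odd_partition P).
Proof.
apply: (iffP andP) => -[partP oddP]; split=> //.
  move=> A PA x Ax; rewrite -(degree_induced Ax).
  by move/forall_inP: oddP => /(_ A PA)/forallP.
apply/forall_inP => A PA; apply/forallP => -[x Ax].
by have := degree_induced Ax; rewrite /= => ->; apply: oddP.
Qed.

Lemma bigmin_leq (I : eqType) (r : seq I) (p : pred I) (F : I -> nat) z j :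
  j \in r -> p j -> \big[minn/z]_(i <- r | p i) F i <= F j.
Proof.
move=> rj pj; elim: r rj => // i r IHr; rewrite inE big_cons.
case/orP => [/eqP <-|/IHr le_r]; first by rewrite pj geq_minl.
by case: (p i) => //; rewrite geq_min le_r orbT.
Qed.

Lemma chi_odd_leq (P : {set {set G}}) : odd_partition P -> chi_odd G <= #|P|.
Proof. by move=> oP; apply: bigmin_leq; rewrite ?mem_index_enum. Qed.

(** The first hypothesis handles the default value of the minimum. *)
Lemma leq_chi_odd n : n <= #|G|.+1 ->
  (forall P : {set {set G}}, odd_partition P -> n <= #|P|) -> n <= chi_odd G.
Proof.
move=> len leP; apply: (big_rec (fun k => n <= k)) => // P k oP lek.
by rewrite leq_min leP.
Qed.

(** Consecutive vertices of a walk in [X] share a bag, which links the connected sets of nodes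
    belonging to them. *)
Lemma connected_parts_bags (T : sgraph) (bag : T -> {set G}) (X : {set G}) :
  tree_decomposition bag -> connected_set X ->
  connected_set [set t | ~~ [disjoint bag t & X]].
Proof.
case=> _ _ edge_bag conT /connected_setP conX; set S := [set t | _].
have Sbag x t : x \in X -> x \in bag t -> t \in S.
  move=> Xx tx; rewrite inE -setI_eq0; apply/set0Pn.
  by exists x; rewrite inE tx.
have conbag x s t : x \in X -> x \in bag s -> x \in bag t ->
    connect (adj_in S) s t.
  move=> Xx sx tx.
  apply: (@connect_adj_in_sub _ [set t | x \in bag t]).
    by apply/subsetP => r; rewrite inE; apply: Sbag.
  have /connected_setP := induced_connected_set (conT x).
  by apply; rewrite inE.
apply/connected_setP => s t; rewrite !inE -!setI_eq0.
move=> /set0Pn[x /setIP[sx Xx]] /set0Pn[y /setIP[ty Xy]].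
suff: forall z, connect (adj_in X) x z ->
    forall t, z \in bag t -> connect (adj_in S) s t.
  by move/(_ _ (conX x y Xx Xy) t ty).
apply: connect_ind => [r rx|a b _ /and3P[Xa Xb ab] IH r rb].
  exact: conbag Xx _ _.
have [q /andP[qa qb]] := edge_bag a b ab.
exact: connect_trans (IH q qa) (conbag b q r Xb qb rb).
Qed.

Lemma tree_decomposition_chi_odd (T : sgraph) (bag : T -> {set G}) m :
  even_components G -> tree_decomposition bag ->
  (forall t, #|bag t| <= m.+1) -> chi_odd G <= m.+1.
Proof.
move=> evG decT lebag.
have [P [partP conP oddP]] := odd_connected_partition evG.
have [[_ _ acyT] _ edge_bag _] := decT.
have [/eqP covP trivP _] := and3P partP.
have Ppb x : pblock P x \in P by rewrite pblock_mem // covP inE.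
have pbx x : x \in pblock P x by rewrite mem_pblock covP inE.
(* The colouring is indexed by all of [{set G}]; sets outside [P] get the empty subtree, which meets
   nothing. *)
pose S (X : {set G}) := if X \in P then [set t | ~~ [disjoint bag t & X]] else set0.
have [||c cP] := @subtree_coloring T {set G} m S acyT.
- move=> X; rewrite /S; case: ifP => [PX|_].
    exact: connected_parts_bags (conP X PX).
  by apply/connected_setP => x y; rewrite inE.
- move=> t; apply: leq_trans (lebag t).
  apply: leq_trans (leq_imset_card (pblock P) (bag t)).
  apply: subset_leq_card; apply/subsetP => X; rewrite inE /S.
  case: ifP => [PX|_]; rewrite inE // -setI_eq0.
  move=> /set0Pn[x /setIP[tx Xx]]; apply/imsetP; exists x => //.
  by rewrite (def_pblock trivP PX Xx).
pose col x := c (pblock P x).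
(* Adjacent vertices share a bag, so the subtrees of their parts intersect. *)
have colE x y : adj x y -> (col x == col y) = (pblock P x == pblock P y).
  move=> xy; have [eqp|neqp] := eqVneq (pblock P x) (pblock P y).
    by rewrite /col eqp eqxx.
  apply: negbTE; apply: cP => //; rewrite /S !Ppb -setI_eq0; apply/set0Pn.
  have [t /andP[tx ty]] := edge_bag x y xy.
  by exists t; rewrite !inE -!setI_eq0; apply/andP; split; apply/set0Pn;
    [exists x | exists y]; rewrite inE ?tx ?ty pbx.
pose R := preim_partition col [set: G].
have oR : odd_partition R.
  apply/odd_partitionP; split; first exact: preim_partitionP.
  move=> _ /imsetP[z _ ->] x; rewrite !inE /= => /eqP colzx.
  (* No neighbour of [x] in another part has the colour of [x], so merging parts leaves its inner
     degree unchanged. *)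
  suff -> : inner_degree [set y in [set: G] | col z == col y] x =
            inner_degree (pblock P x) x by exact: oddP.
  apply: eq_card => y; rewrite !inE.
  case xy: (adj x y); rewrite ?andbF // !andbT.
  by rewrite colzx colE // eq_pblock // covP inE.
apply: leq_trans (chi_odd_leq oR) _; rewrite -[leqRHS]card_ord.
apply: leq_trans (leq_imset_card (fun k => [set y | k == col y]) 'I_m.+1).
apply: subset_leq_card; apply/subsetP => _ /imsetP[x _ ->].
by apply/imsetP; exists (col x) => //; apply/setP => y; rewrite !inE.
Qed.

End OddPartition.

(** * Split graphs and their star-shaped decompositions *)

Section Star.
Variable W : finType.

(** The centre is [None], and the elements of [W] are the leaves. *)
Definition star_adj : rel (option W) := fun a b => (a == None) != (b == None).

Lemma star_sym : symmetric star_adj.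
Proof. by move=> a b; rewrite /star_adj eq_sym. Qed.

Lemma star_irr : irreflexive star_adj.
Proof. by move=> a; rewrite /star_adj eqxx. Qed.

Definition star : sgraph := SGraph star_sym star_irr.

Lemma star_tree : is_tree star.
Proof.
split; first by apply/card_gt0P; exists None.
- suff H x : connect (@adj star) None x.
    move=> x y; apply: connect_trans (H y).
    by rewrite (sym_connect_sym star_sym).
  by case: x => [w|]; [apply: connect1 | apply: connect0].
(* A closed walk meets the centre at every second step, so three or more distinct vertices are
   impossible. *)
- case=> [|a [|b [|c s]]] //= /andP[aN /andP[bN _]] /and3P[ab bc cs].
  move: aN bN ab bc cs; rewrite !inE /star_adj !negb_or.
  case: a b c => [a|] [b|] [c|] //=; rewrite ?eqxx ?andbF //.
  case: s => [|[d|] s] /= ; rewrite /star_adj ?inE ?eqxx ?orbT ?andbF //=.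
Qed.

End Star.

Section SplitGraph.
Variables (k : nat) (W : finType) (nb : W -> {set 'I_k.+1}).

(** A clique and an independent set [W]: both tightness examples have this shape. *)
Definition split_adj : rel ('I_k.+1 + W) := fun x y =>
  match x, y with
  | inl i, inl j => i != j
  | inl i, inr w => i \in nb w
  | inr w, inl i => i \in nb w
  | inr _, inr _ => false
  end.

Lemma split_sym : symmetric split_adj.
Proof. by case=> [i|w] [j|v] //=; rewrite eq_sym. Qed.

Lemma split_irr : irreflexive split_adj.
Proof. by case=> [i|w] //=; rewrite eqxx. Qed.

Definition split_graph : sgraph := SGraph split_sym split_irr.

(** The leaf bags are closed neighbourhoods of vertices of [W], so they have at most [k.+1] elements
    once [#|nb w| <= k]. *)
Definition split_bag (t : star W) : {set split_graph} :=
  if t is Some w then inr w |: [set inl i | i in nb w]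
  else [set inl i | i : 'I_k.+1].

Lemma split_decomposition : tree_decomposition split_bag.
Proof.
have inlE i (A : {set 'I_k.+1}) :
    ((inl i : split_graph) \in [set inl j | j in A]) = (i \in A).
  by rewrite mem_imset // => a b [].
split; first exact: star_tree.
- case=> [i|w]; first by exists None; rewrite imset_f.
  by exists (Some w); rewrite !inE eqxx.
- case=> [i|w] [j|v] //= ij.
  + by exists None; rewrite !imset_f.
  + by exists (Some v); rewrite !inE inlE ij eqxx.
  + by exists (Some w); rewrite !inE inlE ij eqxx orbT.
- case=> [i|w].
    have N0 : None \in [set t | inl i \in split_bag t] by rewrite inE imset_f.
    set H := induced _; pose o : H := Sub None N0.
    have Ho (s : H) : connect (@adj H) o s.
      case: s => -[v|] p; last first.
        by rewrite (bool_irrelevance p N0) connect0.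
      exact: connect1.
    move=> s t; apply: connect_trans (Ho t).
    by rewrite (sym_connect_sym (@adj_sym H)).
  move=> [s sP] [t tP].
  have loc (r : star W) : inr w \in split_bag r -> r = Some w.
    case: r => [v|] /=; last by case/imsetP.
    by rewrite !inE => /orP[/eqP[->]//|/imsetP[]].
  have es : s = Some w by apply: loc; move: sP; rewrite /= inE.
  have et : t = Some w by apply: loc; move: tP; rewrite /= inE.
  move: sP tP; rewrite es et => sP tP.
  by rewrite (bool_irrelevance sP tP) connect0.
Qed.

Hypothesis nb_gt0 : forall w, nb w != set0.
Hypothesis nb_le : forall w, #|nb w| <= k.

Lemma card_split_bag t : #|split_bag t| <= k.+1.
Proof.
case: t => [w|] /=; last first.
  by apply: leq_trans (leq_imset_card _ _) _; rewrite card_ord.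
apply: leq_trans (leq_card_setU _ _) _; rewrite cards1 add1n ltnS.
by apply: leq_trans (leq_imset_card _ _) _.
Qed.

Lemma split_graph_connected : connected_graph split_graph.
Proof.
have H x : connect (@adj split_graph) (inl ord0) x.
  have Hi i : connect (@adj split_graph) (inl ord0) (inl i).
    have [->|i0] := eqVneq i ord0; first exact: connect0.
    by apply: connect1; rewrite /= eq_sym.
  case: x => [//|w]; have /set0Pn[i iw] := nb_gt0 w.
  by apply: connect_trans (Hi i) (connect1 _).
move=> x y; apply: connect_trans (H y).
by rewrite (sym_connect_sym (@adj_sym split_graph)).
Qed.

Hypothesis evenW : ~~ odd (k.+1 + #|W|).

Lemma split_even_components : even_components split_graph.
Proof.
move=> x; suff -> : component x = [set: split_graph].
  by rewrite cardsT card_sum card_ord.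
by apply/setP => y; rewrite !inE; apply: split_graph_connected.
Qed.

Hypothesis rainbow : forall P : {set {set split_graph}}, odd_partition P ->
  injective (fun i => pblock P (inl i)).

(** The clique vertices alone occupy [k.+1] distinct blocks. *)
Lemma split_chi_odd : k < chi_odd split_graph.
Proof.
apply: leq_chi_odd => [|P oP].
  by rewrite card_sum card_ord ltnS (leq_trans (leqnSn k)) ?leq_addr.
have /andP[/and3P[/eqP covP _ _] _] := oP.
rewrite -[leqLHS]card_ord -(card_imset _ (rainbow oP)).
apply: subset_leq_card; apply/subsetP => _ /imsetP[i _ ->].
by rewrite pblock_mem // covP inE.
Qed.

End SplitGraph.

(** * Comparison with tree-width *)

Lemma treewidth_leq (G T : sgraph) (bag : T -> {set G}) m :
  tree_decomposition bag -> (forall t, #|bag t| <= m) ->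
  (treewidth G + 1 <= m%:Z)%R.
Proof.
move=> dec le_m; rewrite /treewidth subrK lez_nat; case: ex_minnP => n _ minn.
apply: leq_trans (minn (\max_t #|bag t|) _) _; last exact/bigmax_leqP.
by apply/asboolP; exists T, bag.
Qed.

Lemma chi_odd_treewidth (G : sgraph) : even_components G ->
  ((chi_odd G)%:Z <= treewidth G + 1)%R.
Proof.
move=> evG; rewrite /treewidth subrK lez_nat.
case: ex_minnP => n /asboolP[T [bag [dec maxn]]] _.
have le_n t : #|bag t| <= n by rewrite -maxn (leq_bigmax t).
case: n {maxn} le_n => [|n] le_n; last exact: tree_decomposition_chi_odd dec le_n.
(* All bags are empty, so [G] has no vertices and the partition without blocks is odd. *)
have G0 (x : G) : False.
  case: dec => _ /(_ x)[t tx] _ _; have := le_n t.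
  by rewrite leqn0 cards_eq0 => /eqP e; rewrite e inE in tx.
rewrite -(@cards0 {set G}); apply: chi_odd_leq; apply/odd_partitionP; split.
  have -> : [set: G] = set0 by apply/setP => x; case: (G0 x).
  by rewrite partition_set0.
by move=> A; rewrite inE.
Qed.

(** * Blocks forced apart, and tightness *)

Section Rainbow.
Variable G : sgraph.
Variables (P : {set {set G}}) (oddP : odd_partition P).

Lemma odd_block_degree x : odd (inner_degree (pblock P x) x).
Proof.
have /odd_partitionP[/and3P[/eqP covP _ _] oP] := oddP.
have covx : x \in cover P by rewrite covP inE.
by apply: oP; rewrite ?pblock_mem ?mem_pblock.
Qed.

Lemma mem_odd_block x y : (y \in pblock P x) = (pblock P x == pblock P y).
Proof.
have /odd_partitionP[/and3P[/eqP covP triP _] _] := oddP.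
by rewrite eq_pblock // covP inE.
Qed.

(** If [y] and [z] shared a block, the degree of [x] inside its own block would be 0 or 2. *)
Lemma pblock_common_nbr x y z :
  y != z -> (forall t, adj x t = (t == y) || (t == z)) -> pblock P y != pblock P z.
Proof.
move=> yz xE; apply: contraTN (odd_block_degree x) => /eqP eqyz.
have zB : (z \in pblock P x) = (y \in pblock P x) by rewrite !mem_odd_block eqyz.
have -> : inner_degree (pblock P x) x =
    #|if y \in pblock P x then [set y; z] else set0|.
  apply: eq_card => t; rewrite inE xE.
  have [->|ty] := eqVneq t y; first by case: ifP; rewrite !inE ?eqxx.
  have [->|tz] := eqVneq t z; first by rewrite zB; case: ifP; rewrite !inE ?eqxx ?orbT.
  by case: ifP; rewrite !inE ?(negPf ty) ?(negPf tz) andbF.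
by case: ifP; rewrite ?cards0 // cards2 yz.
Qed.

(** An odd degree is nonzero, so the only neighbour of [x] lies in its block. *)
Lemma pblock_leaf x y : (forall t, adj x t = (t == y)) -> pblock P x = pblock P y.
Proof.
move=> xE; have := odd_block_degree x; rewrite /inner_degree.
have [->|/set0Pn[t]] := eqVneq [set z in pblock P x | adj x z] set0.
  by rewrite cards0.
by rewrite inE xE mem_odd_block => /andP[/eqP-> /eqP->].
Qed.

End Rainbow.

Definition pair_nb k (p : 'I_k.+1 * 'I_k.+1) := [set p.1; p.2].

Lemma pair_nb_rainbow k (P : {set {set split_graph (@pair_nb k)}}) :
  odd_partition P -> injective (fun i => pblock P (inl i)).
Proof.
move=> oP i j eqij; apply/eqP/negPn/negP => ij.
have : pblock P (inl i) != pblock P (inl j).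
  apply: (pblock_common_nbr oP (x := inr (i, j))) => [|[t|w]] //=.
  by rewrite !inE.
by rewrite eqij eqxx.
Qed.

(** An edge with one pendant vertex at each end: the path on four vertices. *)
Definition pendant_nb (i : 'I_2) := [set i].

(** Each pendant vertex shares the block of its neighbour, so if [i] and [j] shared a block, [i]
    would have degree 2 in it. *)
Lemma pendant_rainbow (P : {set {set split_graph pendant_nb}}) :
  odd_partition P -> injective (fun i => pblock P (inl i)).
Proof.
move=> oP i j eqij; apply/eqP/negPn/negP => ij.
have leaf a : pblock P (inr a) = pblock P (inl a).
  by apply: pblock_leaf => // -[t|w] //=; rewrite !inE.
have := odd_block_degree oP (inl i); rewrite /inner_degree.
have -> : [set y in pblock P (inl i) | @adj (split_graph pendant_nb) (inl i) y] =
    [set (inl j : split_graph pendant_nb); inr i].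
  apply/setP => t; rewrite !inE mem_odd_block //.
  case: t => [t|w] /=; rewrite ?inE.
    have [eqit|it] := eqVneq i t; rewrite ?andbF ?orbF.
      by apply/esym/negbTE; apply: contra ij => /eqP[<-]; rewrite eqit.
    have -> : t = j.
      by move: i j t ij it {eqij} => [[|[|i]] ?] [[|[|j]] ?] [[|[|t]] ?] //= _ _;
        apply: val_inj.
    by rewrite eqij !eqxx.
  have [->|iw] := eqVneq i w; first by rewrite leaf !eqxx.
  by rewrite andbF; apply/esym/negbTE; apply: contra iw => /eqP[->].
by rewrite cards2.
Qed.

(** The chain [k.+1 <= chi_odd <= treewidth + 1 <= k.+1] collapses to equalities. *)
Lemma split_graph_tight k (W : finType) (nb : W -> {set 'I_k.+1}) :
  (forall w, nb w != set0) -> (forall w, #|nb w| <= k) ->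
  ~~ odd (k.+1 + #|W|) ->
  (forall P : {set {set split_graph nb}}, odd_partition P ->
     injective (fun i => pblock P (inl i))) ->
  exists G : sgraph,
    [/\ even_components G, (treewidth G = k%:Z)%R
      & ((chi_odd G)%:Z = treewidth G + 1)%R].
Proof.
move=> nb0 nbk evW rbw; exists (split_graph nb).
have evG := split_even_components nb0 evW.
have le1 := chi_odd_treewidth evG.
have le2 := treewidth_leq (split_decomposition nb) (card_split_bag nbk).
have le3 := split_chi_odd rbw.
have tw1 : (treewidth (split_graph nb) + 1 = k.+1%:Z)%R.
  by apply/le_anti; rewrite le2 (le_trans _ le1).
split=> //; last by apply/le_anti; rewrite le1 tw1 lez_nat.
by apply: (addIr 1%R); rewrite tw1 -addn1 PoszD.
Qed.

Theorem theorem7 :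
  (forall G : sgraph, even_components G ->
     ((chi_odd G)%:Z <= treewidth G + 1)%R) /\
  (forall k : nat, (1 <= k)%N ->
     exists G : sgraph,
       [/\ even_components G, (treewidth G = k%:Z)%R
         & ((chi_odd G)%:Z = treewidth G + 1)%R]).
Proof.
split; first exact: chi_odd_treewidth.
case=> [//|[_|k _]].
  apply: split_graph_tight pendant_rainbow => [w|w|].
  - by apply/set0Pn; exists w; rewrite inE.
  - by rewrite cards1.
  - by rewrite card_ord.
(* A pair has at most two elements, which fits under the bound [k.+2] on [#|nb w|]. *)
apply: split_graph_tight (@pair_nb_rainbow k.+2) => [w|w|].
- by apply/set0Pn; exists w.1; rewrite !inE eqxx.
- by rewrite cards2; case: (_ != _).
(* The order is [k.+3 * k.+4], a product of consecutive numbers. *)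
- by rewrite card_prod card_ord -mulnS oddM /=; case: (odd k).
Qed.
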